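(* Let $\mathcal{T}(n)$ be the $n$-model of trees defined in the context. (1) For any $n$-formulas $\varphi,\psi\in\mathsf{MR}$, if $\varphi\not\vdash\psi$ (in intuitionistic propositional logic), then there exists a node in $\mathcal{T}(n)$ verifying $\varphi$ and falsifying $\psi$. (2) For each upset $U$ of $\mathcal{T}(n)$, there exists a $\mathsf{NNIL}$-formula $\beta^+(U)$ such that for each $T_u\in\mathcal{T}(n)$, $T_u\models\beta^+(U)$ iff $T_u\in U$. In particular, for each node $T_w$ in $\mathcal{T}(n)$, there exists a $\mathsf{NNIL}$-formula $\beta^+(w)$ such that for each $T_u\in\mathcal{T}(n)$, $T_u\models\beta^+(w)$ iff $T_w\leq T_u$.
   Context: Formulas are built from propositional variables and $\bot$ by $\wedge,\vee,\to$ (with $\neg\varphi:=\varphi\to\bot$). Kripke models are $(W,R,V)$ with $R$ a partial order on a nonempty $W$ and $V$ a persistent valuation, with the standard intuitionistic truth relation. An $n$-formula uses only $n$ fixed variables $p_1,\dots,p_n$ ; an $n$-model has its valuation restricted to these. The color $col(w)\in\{0,1\}^n$ of a world $w$ in an $n$-model has $k$-th entry $1$ iff $p_k$ is true at $w$; colors are ordered coordinatewise, and $c<c'$ means $c\le c'$ and $c\ne c'$. A color-preserving monotonic map $f:\mathfrak N\to\mathfrak M$ between $n$-models is an order-preserving function on worlds with $col(f(w))=col(w)$. $\mathfrak M\leq\mathfrak N$ means there is a color-preserving monotonic map from $\mathfrak N$ to $\mathfrak M$ (note the direction). A $\mathsf{NNIL}$-formula is one with no nesting of implications to the left, i.e.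 no implication occurs in the antecedent of an implication. An $n$-formula $\varphi$ is in $\mathsf{MR}$ if it is reflected by color-preserving monotonic maps: for all $n$-models $\mathfrak N,\mathfrak M$, every color-preserving monotonic $f:\mathfrak N\to\mathfrak M$ and every world $w$ of $\mathfrak N$, $\mathfrak M,f(w)\models\varphi$ implies $\mathfrak N,w\models\varphi$. The $n$-model $\mathcal T(n)=(W,\leq,V)$: its nodes are finite rooted tree-like $n$-models $T_w$ (with root $w$), taken up to isomorphism, defined in layers. Layer 1 consists of the $2^n$ single-node trees, one of each color. Given layers $\le m$, layer $m+1$ consists of all trees obtained as follows: for every set $X=\{T_{w_1},\dots,T_{w_k}\}$ ($k\geq 1$) of pairwise $\leq$-incomparable trees in layers $\le m$ containing at least one member of layer $m$, and every color $c$ strictly smaller than the root colors of all trees in $X$, take the disjoint union of the trees in $X$ and add a fresh root $w$ of color $c$ below. The nodes are ordered by the relation $\leq$, and the color of the node $T_w$ in $\mathcal T(n)$ is the color of the root $w$ of $T_w$. For $T_u\in\mathcal T(n)$, $T_u\models\varphi$ means $\mathcal T(n),T_u\models\varphi$ or equivalently $T_u,u\models\varphi$ (these coincide for $\mathsf{NNIL}$- and $\mathsf{MR}$-formulas in $n$ variables). ''A node verifies $\varphi$'' means $T_w\models\varphi$, and ''falsifies $\psi$'' means $T_w\not\models\psi$. *)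

(* Defs.v *)
From Stdlib Require List.
From HB Require Import structures.
From mathcomp Require Import all_boot.
From mathcomp Require Import boolp.

Set Implicit Arguments.
Unset Strict Implicit.
Unset Printing Implicit Defensive.

Local Open Scope quotient_scope.

(* n-formulas; the variables p_1, ..., p_n are [Var i] with [i : 'I_n]. *)
Inductive form (n : nat) : Type :=
| Var of 'I_n
| Bot
| And of form n & form n
| Or of form n & form n
| Imp of form n & form n.

Arguments Bot {n}.

(* Natural deduction for intuitionistic propositional logic. *)
Inductive ipc (n : nat) (G : seq (form n)) : form n -> Prop :=
| ipc_ax a : List.In a G -> ipc G a
| ipc_botE a : ipc G Bot -> ipc G a
| ipc_andI a b : ipc G a -> ipc G b -> ipc G (And a b)
| ipc_andE1 a b : ipc G (And a b) -> ipc G a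
| ipc_andE2 a b : ipc G (And a b) -> ipc G b
| ipc_orI1 a b : ipc G a -> ipc G (Or a b)
| ipc_orI2 a b : ipc G b -> ipc G (Or a b)
| ipc_orE a b c :
    ipc G (Or a b) -> ipc (a :: G) c -> ipc (b :: G) c -> ipc G c
| ipc_impI a b : ipc (a :: G) b -> ipc G (Imp a b)
| ipc_impE a b : ipc G (Imp a b) -> ipc G a -> ipc G b.

Definition entails n (a b : form n) : Prop := ipc [:: a] b.

Fixpoint imp_free n (a : form n) : bool :=
  match a with
  | Var _ | Bot => true
  | And b c | Or b c => imp_free b && imp_free c
  | Imp _ _ => false
  end.

Fixpoint NNIL n (a : form n) : bool :=
  match a with
  | Var _ | Bot => true
  | And b c | Or b c => NNIL b && NNIL c
  | Imp b c => imp_free b && NNIL c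
  end.

Definition color (n : nat) := {ffun 'I_n -> bool}.

Definition color_le n (c d : color n) : bool := [forall k, c k ==> d k].

Definition color_lt n (c d : color n) : bool := color_le c d && (c != d).

(* The data (W, R, V) of an n-model, without its laws: trees are compared by
   color-preserving monotonic maps while they are being built, so it is
   convenient to have these maps before the laws are known. *)
Record kripke (n : nat) := Kripke {
  world :> Type;
  le : world -> world -> Prop;
  valuation : 'I_n -> world -> Prop
}.

Arguments le {n M} : rename.
Arguments valuation {n M} : rename.

Record is_nmodel n (M : kripke n) : Prop := IsNModel {
  nm_inhabited : exists w : M, True;
  nm_refl : forall w : M, le w w;
  nm_trans : forall u v w : M, le u v -> le v w -> le u w;
  nm_antisym : forall u v : M, le u v -> le v u -> u = v;
  nm_persistent : forall k (u v : M), le u v -> valuation k u -> valuation k v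
}.

Record nmodel (n : nat) := NModel {
  nmodel_kripke :> kripke n;
  nmodelP : is_nmodel nmodel_kripke
}.

Fixpoint forces n (M : kripke n) (w : M) (a : form n) : Prop :=
  match a with
  | Var k => valuation k w
  | Bot => False
  | And b c => forces w b /\ forces w c
  | Or b c => forces w b \/ forces w c
  | Imp b c => forall v : M, le w v -> forces v b -> forces v c
  end.

Definition col n (M : kripke n) (w : M) : color n := [ffun k => `[< valuation k w >]].

Definition cpm_map n (N M : kripke n) (f : N -> M) : Prop :=
  (forall u v : N, le u v -> le (f u) (f v)) /\
  (forall w : N, col (f w) = col w).

(* Note the direction. *)
Definition kripke_le n (M N : kripke n) : Prop :=
  exists f : N -> M, cpm_map f.

Definition kripke_iso n (M N : kripke n) : Prop :=
  exists f : M -> N,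
    [/\ bijective f,
        forall u v : M, le u v <-> le (f u) (f v)
      & forall w : M, col (f w) = col w].

Definition MR n (a : form n) : Prop :=
  forall (N M : nmodel n) (f : N -> M), cpm_map f ->
  forall w : N, forces (f w) a -> forces w a.

(* The disjoint union of the [M i] with a fresh root [None] of color [c]
   below everything. *)
Section AddRoot.
Variables (n : nat) (c : color n) (k : nat) (M : 'I_k -> kripke n).

Let W := option {i : 'I_k & M i}.

Inductive add_root_le : W -> W -> Prop :=
| root_below (x : W) : add_root_le None x
| child_le (i : 'I_k) (x y : M i) : le x y ->
    add_root_le (Some (existT _ i x)) (Some (existT _ i y)).

Definition add_root_valuation (p : 'I_n) (x : W) : Prop :=
  if x is Some (existT i y) then valuation p y else c p.

Definition add_root : kripke n := Kripke add_root_le add_root_valuation.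

End AddRoot.

(* Finite rooted trees with nodes labelled by colors. *)
Inductive tree (n : nat) : Type :=
  Node (c : color n) (k : nat) (ch : 'I_k -> tree n).

HB.instance Definition _ n := gen_eqMixin (tree n).
HB.instance Definition _ n := gen_choiceMixin (tree n).

Definition root_color n (t : tree n) : color n := let: Node c _ _ := t in c.

Fixpoint tree_model n (t : tree n) : kripke n :=
  let: Node c _ ch := t in add_root c (fun i => tree_model (ch i)).

Definition tree_le n (t u : tree n) : Prop :=
  kripke_le (tree_model t) (tree_model u).

(* [layer m t]: up to isomorphism, [t] lies in layer [m] of T(n) (m >= 1).  A set
   X of pairwise incomparable trees is given by representatives [ch i] of its
   members; incomparability makes them pairwise non-isomorphic. *)
Inductive layer (n : nat) : nat -> tree n -> Prop :=
| layer_single (c : color n) (ch : 'I_0 -> tree n) : layer 1 (Node c ch)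
| layer_next (m : nat) (c : color n) (k : nat) (ch : 'I_k -> tree n) :
    (forall i, exists2 l, l <= m & layer l (ch i)) ->
    (exists i, layer m (ch i)) ->
    (forall i j, i <> j -> ~ tree_le (ch i) (ch j)) ->
    (forall i, color_lt c (root_color (ch i))) ->
    layer m.+1 (Node c ch).

Definition layered n (t : tree n) : Prop := exists m, layer m t.

Lemma cpm_map_id n (M : kripke n) : cpm_map (fun w : M => w).
Proof. by split. Qed.

Lemma cpm_map_comp n (M N P : kripke n) (f : M -> N) (g : N -> P) :
  cpm_map f -> cpm_map g -> cpm_map (fun w => g (f w)).
Proof.
move=> [f1 f2] [g1 g2]; split=> [u v uv|w]; first exact/g1/f1.
by rewrite g2 f2.
Qed.

Lemma kripke_le_refl n (M : kripke n) : kripke_le M M.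
Proof. by exists (fun w => w); apply: cpm_map_id. Qed.

Lemma kripke_le_trans n (M N P : kripke n) :
  kripke_le M N -> kripke_le N P -> kripke_le M P.
Proof.
by move=> [f cf] [g cg]; exists (fun w => f (g w)); apply: cpm_map_comp cg cf.
Qed.

Lemma kripke_iso_refl n (M : kripke n) : kripke_iso M M.
Proof. by exists (fun w => w); split=> //; exists (fun w => w). Qed.

Lemma kripke_iso_sym n (M N : kripke n) : kripke_iso M N -> kripke_iso N M.
Proof.
move=> [f [[g fK gK] fle fcol]]; exists g; split; first by exists f.
  by move=> u v; rewrite -{1}(gK u) -{1}(gK v); split=> /fle.
by move=> w; rewrite -{2}(gK w) fcol.
Qed.

Lemma kripke_iso_trans n (M N P : kripke n) :
  kripke_iso M N -> kripke_iso N P -> kripke_iso M P.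
Proof.
move=> [f [fb fle fcol]] [g [gb gle gcol]].
exists (g \o f); split; first exact: bij_comp.
  move=> u v /=; split=> [/fle/gle //|/gle/fle //].
by move=> w /=; rewrite gcol fcol.
Qed.

Lemma kripke_iso_le n (M N : kripke n) : kripke_iso M N -> kripke_le M N.
Proof.
by move=> /kripke_iso_sym [f [_ fle fcol]]; exists f; split=> // u v /fle.
Qed.

Lemma color_leP n (c d : color n) :
  reflect (forall k, c k -> d k) (color_le c d).
Proof. by apply: (iffP forallP) => cd k; apply/implyP/cd. Qed.

Lemma color_le_refl n (c : color n) : color_le c c.
Proof. exact/color_leP. Qed.

Lemma color_lt_le_trans n (c d e : color n) :
  color_lt c d -> color_le d e -> color_lt c e.
Proof.
move=> /andP[/color_leP cd ncd] /color_leP de; apply/andP; split.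
  by apply/color_leP => k /cd /de.
apply: contraNneq ncd => ce; apply/eqP/ffunP => k; apply/idP/idP => [/cd //|].
by move=> /de; rewrite ce.
Qed.

Lemma color_lt_irr n (c : color n) : ~~ color_lt c c.
Proof. by rewrite /color_lt eqxx andbF. Qed.

Lemma col_le n (M : kripke n) : is_nmodel M ->
  forall u v : M, le u v -> color_le (col u) (col v).
Proof.
move=> hM u v uv; apply/color_leP => k; rewrite !ffunE => /asboolP ku.
exact/asboolP/(nm_persistent hM uv).
Qed.

Lemma add_root_leE n (c : color n) k (M : 'I_k -> kripke n)
    (x y : add_root c M) :
  le x y <->
  match x, y with
  | None, _ => True
  | Some _, None => False
  | Some (existT i u), Some (existT j v) =>
      exists e : i = j, le (eq_rect i (fun l => world (M l)) u j e) v
  end.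
Proof.
split; first by case=> // i u v uv; exists erefl.
case: x y => [[i u]|] [[j v]|] //; try by move=> _; constructor.
by move=> [e]; case: j / e v => v; constructor.
Qed.

Lemma add_root_le_child n (c : color n) k (M : 'I_k -> kripke n) i
    (u v : M i) :
  @le _ (add_root c M) (Some (existT _ i u)) (Some (existT _ i v)) <-> le u v.
Proof.
rewrite add_root_leE; split=> [[e]|uv]; last by exists erefl.
by rewrite (eq_irrelevance e erefl).
Qed.

Lemma add_root_le_above n (c : color n) k (M : 'I_k -> kripke n) i (u : M i)
    (y : add_root c M) :
  @le _ (add_root c M) (Some (existT _ i u)) y ->
  exists v : M i, y = Some (existT _ i v).
Proof.
move/add_root_leE; case: y => [[j v]|] // [e _].
by case: j / e v => v; exists v.
Qed.

Lemma col_root n (c : color n) k (M : 'I_k -> kripke n) :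
  @col n (add_root c M) None = c.
Proof. by apply/ffunP => p; rewrite ffunE asboolb. Qed.

Lemma col_child n (c : color n) k (M : 'I_k -> kripke n) i (u : M i) :
  @col n (add_root c M) (Some (existT _ i u)) = col u.
Proof. by apply/ffunP => p; rewrite !ffunE. Qed.

Lemma tree_root n (t : tree n) :
  exists r : tree_model t,
    (forall x, le r x) /\ col r = root_color t.
Proof.
by case: t => c k ch; exists None; split=> [x|]; [constructor|exact: col_root].
Qed.

Lemma layered_inv n (t : tree n) :
  layered t ->
  let: Node c _ ch := t in
  [/\ forall i, layered (ch i),
      forall i j, i <> j -> ~ tree_le (ch i) (ch j)
    & forall i, color_lt c (root_color (ch i))].
Proof.
case=> m; case=> [c ch|m' c k ch h1 _ h3 h4].
  by split=> -[].
by split=> // i; case: (h1 i) => l _ hl; exists l.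
Qed.

Lemma layered_nmodel n (t : tree n) : layered t -> is_nmodel (tree_model t).
Proof.
elim: t => c k ch IH /layered_inv[hch _ hc].
have {}IH i := IH i (hch i).
split; first by exists None.
- case=> [[i u]|] /=; last by constructor.
  by constructor; apply: nm_refl (IH i) _.
- move=> u v w; case=> [x _|i x y xy]; first by constructor.
  move=> yw; have [z ez] := add_root_le_above yw; move: yw.
  rewrite ez => /add_root_le_child yz; apply/add_root_le_child.
  exact: nm_trans (IH i) _ _ _ xy yz.
- move=> u v; case=> [x|i x y xy].
    by move/add_root_leE; case: x => [[]|].
  by move/add_root_le_child => yx; rewrite (nm_antisym (IH i) xy yx).
- move=> p u v; case=> [[[i x]|]|i x y xy] //=; last exact: nm_persistent (IH i) _ _ _ xy.
  move=> cp; have [r [rx er]] := tree_root (ch i).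
  have /andP[/color_leP/(_ p cp) + _] := hc i.
  rewrite -er ffunE => /asboolP; exact: nm_persistent (IH i) _ _ _ (rx x).
Qed.

Lemma root_color_le n (t : tree n) (x : tree_model t) :
  layered t -> color_le (root_color t) (col x).
Proof.
move=> /layered_nmodel ht; have [r [rx <-]] := tree_root t.
exact: (col_le ht).
Qed.

(* Trees of T(n) are rigid; this yields the antisymmetry of the order on T(n). *)
Lemma layered_rigid n (t : tree n) (h : tree_model t -> tree_model t) :
  layered t -> cpm_map h -> forall x, h x = x.
Proof.
elim: t h => c k ch IH h /layered_inv[hch hinc hc] [hle hcol].
have child_lt i (u : tree_model (ch i)) : color_lt c (col u).
  exact: color_lt_le_trans (hc i) (root_color_le u (hch i)).
have not_root i (u : tree_model (ch i)) : h (Some (existT _ i u)) <> None.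
  move=> e; have := hcol (Some (existT _ i u)).
  rewrite e col_child [col _]col_root => ec.
  by have := child_lt i u; rewrite -ec (negPf (color_lt_irr c)).
case=> [[i x]|]; last first.
  case e: (h None) => [[i u]|//]; have := hcol None.
  rewrite e col_child [RHS]col_root => ec.
  by have := child_lt i u; rewrite ec (negPf (color_lt_irr c)).
have [r [rx _]] := tree_root (ch i).
case e: (h (Some (existT _ i r))) => [[j z]|]; last by have := not_root i r.
have /choice[g gE] (u : tree_model (ch i)) :
    exists v : tree_model (ch j), h (Some (existT _ i u)) = Some (existT _ j v).
  apply: (@add_root_le_above _ c _ (fun l => tree_model (ch l)) j z).
  by rewrite -e; apply: hle; apply/add_root_le_child.
have cg : cpm_map g.
  split=> [u v uv|u].
    apply/(@add_root_le_child _ c _ (fun l => tree_model (ch l)) j).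
    by rewrite -!gE; apply: hle; apply/add_root_le_child.
  have := hcol (Some (existT _ i u)).
  by rewrite gE !col_child.
have eji : j = i by apply: contrapT => /hinc; apply; exists g.
move: g gE cg; rewrite eji => g gE cg.
by rewrite gE (IH i g (hch i) cg).
Qed.

Lemma tree_le_antisym n (t u : tree n) : layered t -> layered u ->
  tree_le t u -> tree_le u t -> kripke_iso (tree_model t) (tree_model u).
Proof.
move=> ht hu [f cf] [g cg].
have gf x : f (g x) = x := layered_rigid ht (cpm_map_comp cg cf) x.
have fg x : g (f x) = x := layered_rigid hu (cpm_map_comp cf cg) x.
exists g; split; first by exists f.
  move=> x y; split; first exact: cg.1.
  by move/cf.1; rewrite !gf.
exact: cg.2.
Qed.

Lemma tree_le_root_color n (t u : tree n) : layered t ->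
  tree_le t u -> color_le (root_color t) (root_color u).
Proof.
move=> ht [f [_ fcol]]; have [r [_ <-]] := tree_root u.
by rewrite -fcol; apply: root_color_le.
Qed.

Lemma layered_leaf n (c : color n) : exists t : tree n, layered t.
Proof.
by exists (@Node n c 0 (fun i => match notF (ltn_ord i) with end)), 1; constructor.
Qed.

(* The nodes of T(n): trees occurring in some layer, up to isomorphism. *)
Definition layered_tree (n : nat) := {t : tree n | `[< layered t >]}.

Definition tree_iso n : rel (layered_tree n) := fun t u =>
  `[< kripke_iso (tree_model (sval t)) (tree_model (sval u)) >].

Lemma tree_iso_refl n : reflexive (@tree_iso n).
Proof. by move=> t; apply/asboolP/kripke_iso_refl. Qed.

Lemma tree_iso_sym n : symmetric (@tree_iso n).
Proof.
by move=> t u; apply/asboolP/asboolP; apply: kripke_iso_sym.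
Qed.

Lemma tree_iso_trans n : transitive (@tree_iso n).
Proof.
move=> t u v /asboolP ut /asboolP tv; apply/asboolP.
exact: kripke_iso_trans ut tv.
Qed.

Canonical tree_iso_equiv n :=
  EquivRel (@tree_iso n) (@tree_iso_refl n) (@tree_iso_sym n)
    (@tree_iso_trans n).

Definition Tnode (n : nat) := {eq_quot @tree_iso n}.

Definition Ttree n (w : Tnode n) : tree n := sval (repr w).

(* Order and color do not depend on the representatives, see [Tpi_le] and
   [Tpi_root_color]. *)
Definition Tkripke (n : nat) : kripke n :=
  Kripke (fun w u : Tnode n => tree_le (Ttree w) (Ttree u))
         (fun k w => root_color (Ttree w) k).

Lemma Ttree_layered n (w : Tnode n) : layered (Ttree w).
Proof. exact/asboolP/(svalP (repr w)). Qed.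

Lemma Ttree_pi n (t : layered_tree n) :
  kripke_iso (tree_model (Ttree (\pi_(Tnode n) t))) (tree_model (sval t)).
Proof.
have /eqmodP/asboolP // : repr (\pi_(Tnode n) t) = t %[mod Tnode n].
by rewrite reprK.
Qed.

Lemma Tpi_le n (t u : layered_tree n) :
  @le n (Tkripke n) (\pi t) (\pi u) <-> tree_le (sval t) (sval u).
Proof.
have it := Ttree_pi t; have iu := Ttree_pi u; split=> tu.
  apply: kripke_le_trans (kripke_iso_le (kripke_iso_sym it)) _.
  exact: kripke_le_trans tu (kripke_iso_le iu).
apply: kripke_le_trans (kripke_iso_le it) _.
exact: kripke_le_trans tu (kripke_iso_le (kripke_iso_sym iu)).
Qed.

Lemma color_le_antisym n (c d : color n) :
  color_le c d -> color_le d c -> c = d.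
Proof.
move=> /color_leP cd /color_leP dc; apply/ffunP => k.
by apply/idP/idP => [/cd|/dc].
Qed.

Lemma Tcol n (w : Tkripke n) : col w = root_color (Ttree w).
Proof. by apply/ffunP => k; rewrite ffunE asboolb. Qed.

Lemma Tpi_root_color n (t : layered_tree n) :
  @col n (Tkripke n) (\pi t) = root_color (sval t).
Proof.
rewrite Tcol; have it := Ttree_pi t.
have ht : layered (sval t) by exact/asboolP/(svalP t).
apply: color_le_antisym; apply: tree_le_root_color => //.
- exact: Ttree_layered.
- exact: kripke_iso_le.
- exact/kripke_iso_le/kripke_iso_sym.
Qed.

Lemma Tkripke_is_nmodel n : is_nmodel (Tkripke n).
Proof.
split.
- have [t ht] := @layered_leaf n [ffun=> true].
  by exists (\pi_(Tnode n) (exist _ t (asboolT ht))).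
- by move=> w; apply: kripke_le_refl.
- by move=> u v w; apply: kripke_le_trans.
- move=> u v uv vu; rewrite -[u]reprK -[v]reprK; apply/eqmodP/asboolP.
  by apply: tree_le_antisym uv vu; apply: Ttree_layered.
- move=> k u v uv; have /color_leP := tree_le_root_color (Ttree_layered u) uv.
  exact.
Qed.

Definition Tmodel (n : nat) : nmodel n := NModel (Tkripke_is_nmodel n).

Definition upset n (M : kripke n) (U : M -> Prop) : Prop :=
  forall u v : M, le u v -> U u -> U v.

(* Main.v *)
(** For (1), let [w] be a world of an n-model [M] refuting the entailment.  Among
    the nodes [t] of T(n) that have a color-preserving monotonic map into the part
    of [M] above [w] there is a least one, [T w]: a root of color [col w] below the
    minimal such nodes of a different color.  Then [T : M -> T(n)] is color-preserving
    and monotonic, so [T w] falsifies [psi].  That [T w] verifies [phi] follows from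
    the map [T w -> M] by comparing T(n) and [M] with the model of all pairs
    [(u, g : u -> M)], which avoids unravelling T(n).

    For (2), a node [w] of color [c] with immediate subtrees [w_i] is described by
    the conjunction of the [p] in [c] and of the [p -> \/_i beta+(w_i)] for [p] not
    in [c]: above a node of color at least [c], the color stops being [c] exactly
    when such a [p] becomes true, and from there on a map to [w] has to land in some
    [w_i].  Upsets are finite disjunctions of these, as T(n) is finite. *)

Require Import Defs.
From mathcomp Require Import all_boot.
From mathcomp Require Import boolp classical_sets.

Set Implicit Arguments.
Unset Strict Implicit.
Unset Printing Implicit Defensive.

(** * Completeness of intuitionistic propositional logic for n-models *)

Lemma ipc_weaken n (G H : seq (form n)) a :
  (forall b, List.In b G -> List.In b H) -> ipc G a -> ipc H a.
Proof.
move=> GH Ga; elim: Ga H GH => {G a}.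
- by move=> G a aG H GH; apply/ipc_ax/GH.
- by move=> G a _ IH H GH; apply: ipc_botE; apply: IH.
- by move=> G a b _ IH1 _ IH2 H GH; apply: ipc_andI; [apply: IH1|apply: IH2].
- by move=> G a b _ IH H GH; apply: ipc_andE1 (IH H GH).
- by move=> G a b _ IH H GH; apply: ipc_andE2 (IH H GH).
- by move=> G a b _ IH H GH; apply: ipc_orI1; apply: IH.
- by move=> G a b _ IH H GH; apply: ipc_orI2; apply: IH.
- move=> G a b c _ IH1 _ IH2 _ IH3 H GH; apply: (ipc_orE (IH1 H GH)).
  + by apply: IH2 => d [->|/GH]; [left|right].
  + by apply: IH3 => d [->|/GH]; [left|right].
- move=> G a b _ IH H GH; apply: ipc_impI; apply: IH => d [->|/GH].
  + by left.
  + by right.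
- by move=> G a b _ IH1 _ IH2 H GH; apply: (ipc_impE (IH1 H GH)); apply: IH2.
Qed.

(** Prime theories are infinite while contexts of [ipc] are lists, so derivations draw on a finite
    part of [P]. *)
Definition derives n (P : set (form n)) (a : form n) : Prop :=
  exists2 G, (forall b, List.In b G -> P b) & ipc G a.

Lemma derives_ax n (P : set (form n)) a : P a -> derives P a.
Proof.
move=> Pa; exists [:: a]; first by move=> b [<-|[]].
by apply: ipc_ax; left.
Qed.

Lemma derives_map n (P : set (form n)) a b :
  (forall G, ipc G a -> ipc G b) -> derives P a -> derives P b.
Proof. by move=> ab [G GP /ab Gb]; exists G. Qed.

Lemma derives_map2 n (P : set (form n)) a b c :
  (forall G, ipc G a -> ipc G b -> ipc G c) ->
  derives P a -> derives P b -> derives P c.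
Proof.
move=> abc [G GP Ga] [H HP Hb]; exists (G ++ H).
  by move=> d /List.in_app_iff[/GP|/HP].
apply: abc; [apply: ipc_weaken Ga|apply: ipc_weaken Hb] => d dG.
- by apply/List.in_app_iff; left.
- by apply/List.in_app_iff; right.
Qed.

Lemma derives_mp n (P : set (form n)) a b :
  derives P (Imp a b) -> derives P a -> derives P b.
Proof. by apply: derives_map2 => G; apply: ipc_impE. Qed.

Lemma ipc_or_elim n (G : seq (form n)) a b c :
  ipc G (Or a b) -> ipc G (Imp a c) -> ipc G (Imp b c) -> ipc G c.
Proof.
move=> Gab Gac Gbc; apply: (ipc_orE Gab).
- apply: (@ipc_impE _ _ a); last by apply: ipc_ax; left.
  by apply: ipc_weaken Gac => d; right.
- apply: (@ipc_impE _ _ b); last by apply: ipc_ax; left.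
  by apply: ipc_weaken Gbc => d; right.
Qed.

Lemma derives_imp n (P : set (form n)) a b :
  derives (P `|` [set a])%classic b -> derives P (Imp a b).
Proof.
move=> [G GP Gb].
have [H HP GH] : exists2 H, (forall d, List.In d H -> P d) &
    forall d, List.In d G -> List.In d (a :: H).
  elim: G GP {Gb} => [|x G IH] GP; first by exists [::].
  have [|H HP GH] := IH; first by move=> d dG; apply: GP; right.
  have [Px|->] := GP x (or_introl erefl).
    exists (x :: H); first by move=> d [<-|/HP].
    move=> d [<-|/GH[<-|dH]]; first by right; left.
    + by left.
    + by right; right.
  by exists H => // d [<-|/GH]; [left|].
by exists H => //; apply: ipc_impI; apply: ipc_weaken Gb.
Qed.

Record prime n (P : set (form n)) : Prop := Prime {
  prime_closed : forall a, derives P a -> P a;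
  prime_consistent : ~ P Bot;
  prime_or : forall a b, P (Or a b) -> P a \/ P b
}.

(** Maximality makes every formula outside [Q] imply [b]. Were both disjuncts of a member outside
    [Q], case analysis would give [b]. *)
Lemma lindenbaum n (P : set (form n)) b : ~ derives P b ->
  exists Q, [/\ prime Q, (P `<=` Q)%classic & ~ Q b].
Proof.
move=> Pb.
(* Zorn's lemma also asks for the union of the empty chain; joining [P] to [A], instead of ranging
   over supersets of [P], admits it. *)
have [|A [Ab Amax]] :=
    @Zorn_bigcup _ (fun A => ~ derives (P `|` A)%classic b).
  move=> F FP Ftot [G GP Gb].
  have [GP'|[A FA GA]] : (forall d, List.In d G -> P d) \/
      (exists2 A, F A & forall d, List.In d G -> (P `|` A)%classic d).
  - elim: G GP {Gb} => [|x G IH] GP; first by left.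
    have {}IH := IH (fun d dG => GP d (or_intror dG)).
    case: (GP x (or_introl erefl)) => [Px|[B FB Bx]].
    + case: IH => [IH|[A FA IH]]; first by left=> d [<-|/IH].
      by right; exists A => // d [<-|/IH //]; left.
    + right; case: IH => [IH|[A FA IH]].
        by exists B => // d [<-|/IH]; [right|left].
      case: (Ftot A B FA FB) => sub.
        exists B => // d [<-|/IH[Pd|/sub Bd]]; [by right|by left|by right].
      by exists A => // d [<-|/IH //]; right; apply: sub.
  - by apply: Pb; exists G.
  - by apply: (FP A FA); exists G.
set Q := (P `|` A)%classic.
have Qmax x : Q x \/ derives Q (Imp x b).
  have [Ax|nAx] := pselect (A x); first by left; right.
  right; apply: derives_imp; apply: contrapT => nd.
  apply: (Amax (A `|` [set x])%classic); last by rewrite setUA.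
  split; first by move=> y Ay; left.
  by move=> sub; apply/nAx/sub; right.
exists Q; split.
- split=> [a Qa|QB|a c Qac].
  + by case: (Qmax a) => // Qab; case: Ab; apply: derives_mp Qab Qa.
  + apply: Ab; apply: derives_map (derives_ax QB) => G; exact: ipc_botE.
  + case: (Qmax a) => [|Qab]; first by left.
    case: (Qmax c) => [|Qcb]; first by right.
    have Qa : derives Q (And (Imp a b) (Imp c b)).
      by apply: derives_map2 Qab Qcb => G; apply: ipc_andI.
    case: Ab; apply: derives_map2 (derives_ax Qac) Qa => G Gac Gb.
    exact: ipc_or_elim Gac (ipc_andE1 Gb) (ipc_andE2 Gb).
- by move=> y Py; left.
- by move=> Qb; apply/Ab/derives_ax.
Qed.

Definition canonical n : kripke n :=
  @Kripke n {P : set (form n) | prime P}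
    (fun P Q => (sval P `<=` sval Q)%classic) (fun k P => sval P (Var k)).

Lemma canonical_nmodel n (P : canonical n) : is_nmodel (canonical n).
Proof.
split.
- by exists P.
- by move=> w a.
- by move=> u v w uv vw a /uv/vw.
- move=> [A pA] [B pB] /= AB BA; apply: eq_exist => /=.
  by apply/seteqP.
- by move=> k u v; apply.
Qed.

Lemma canonical_truth n (P : canonical n) a : forces P a <-> sval P a.
Proof.
elim: a P => [k|| a IHa b IHb| a IHa b IHb| a IHa b IHb] P /=;
  have [cl cons or] := svalP P.
- by [].
- by split.
- rewrite IHa IHb; split=> [[Pa Pb]|Pab].
    by apply: cl; apply: derives_map2 (derives_ax Pa) (derives_ax Pb) => G;
      apply: ipc_andI.
  split; apply: cl; apply: derives_map (derives_ax Pab) => G.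
    exact: ipc_andE1.
  exact: ipc_andE2.
- rewrite IHa IHb; split=> [[Pa|Pb]|/or //].
    by apply: cl; apply: derives_map (derives_ax Pa) => G; apply: ipc_orI1.
  by apply: cl; apply: derives_map (derives_ax Pb) => G; apply: ipc_orI2.
- split=> [Pab|Pab Q PQ]; last first.
    rewrite IHa IHb => Qa; have [clQ _ _] := svalP Q; apply: clQ.
    by apply: derives_mp (derives_ax Qa); apply/derives_ax/PQ.
  (* If [P] with [a] did not derive [b], a prime extension omitting [b] would be a world above [P]
     forcing [a] but not [b]. *)
  apply: cl; apply: derives_imp; apply: contrapT => /lindenbaum[Q [pQ PQ nQb]].
  apply: nQb; apply/(IHb (exist _ Q pQ))/Pab.
    by move=> x Px; apply: PQ; left.
  by apply/IHa; apply: PQ; right.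
Qed.

Lemma completeness n (a b : form n) : ~ entails a b ->
  exists (M : nmodel n) (w : M), forces w a /\ ~ forces w b.
Proof.
move=> nab; have [|Q [pQ aQ nQb]] := @lindenbaum n [set a]%classic b.
  move=> [G Ga Gb]; apply: nab; apply: ipc_weaken Gb => d /Ga ->; by left.
pose w : canonical n := exist _ Q pQ.
exists (NModel (canonical_nmodel w)), w; split; first exact/canonical_truth/aQ.
by move/canonical_truth.
Qed.

(** * Maps between models and trees *)

Lemma forces_pmorphism n (M N : kripke n) (f : M -> N) :
  cpm_map f ->
  (forall (u : M) (v : N), le (f u) v -> exists2 u', le u u' & f u' = v) ->
  forall (w : M) a, forces w a <-> forces (f w) a.
Proof.
move=> [fle fcol] fback w a.
elim: a w => [k|| a IHa b IHb| a IHa b IHb| a IHa b IHb] w /=.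
- have /ffunP/(_ k) := fcol w; rewrite !ffunE => e.
  by split=> h; apply/asboolP; [rewrite e|rewrite -e]; apply/asboolP.
- by [].
- by rewrite IHa IHb.
- by rewrite IHa IHb.
- split=> [wab v /fback[u wu <-]|fab v /fle wv]; last by rewrite IHa IHb; apply: fab.
  by rewrite -IHa -IHb; apply: wab.
Qed.

Definition troot n (t : tree n) : tree_model t :=
  match t with Node c k ch => None end.

Lemma troot_le n (t : tree n) (x : tree_model t) : le (troot t) x.
Proof. by case: t x => c k ch x; constructor. Qed.

Lemma col_troot n (t : tree n) : col (troot t) = root_color t.
Proof. by case: t => c k ch; apply: col_root. Qed.

(** Maps out of a tree are assembled from maps of its subtrees. The laws of an n-model are not
    assumed for [M], hence the hypothesis [le r r]. *)
Lemma node_map n (M : kripke n) c k (ch : 'I_k -> tree n) (r : M) :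
  le r r -> col r = c ->
  (forall i, exists2 f : tree_model (ch i) -> M,
     cpm_map f & forall x, le r (f x)) ->
  exists2 f : tree_model (Node c ch) -> M, cpm_map f & f (troot (Node c ch)) = r.
Proof.
move=> rr rc hf; pose f i := s2val (cid2 (hf i)).
have cf i : cpm_map (f i) := s2valP (cid2 (hf i)).
have rf i x : le r (f i x) := s2valP' (cid2 (hf i)) x.
exists (fun x => if x is Some (existT i y) then f i y else r) => //.
split=> [u v|[[i x]|]].
- case=> [[[i x]|]|i x y xy] //; exact: (cf i).1.
- by rewrite col_child (cf i).2.
- by rewrite rc [RHS]col_root.
Qed.

Lemma tree_le_node n c k l (ch : 'I_k -> tree n) (ch' : 'I_l -> tree n) :
  layered (Node c ch) ->
  (forall j, exists i, tree_le (ch i) (ch' j)) ->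
  tree_le (Node c ch) (Node c ch').
Proof.
move=> /layered_nmodel lt hch.
have [||j|f cf _] := @node_map n (tree_model (Node c ch)) c l ch' (troot _).
- exact: nm_refl.
- exact: col_troot.
- have [i [f [fle fcol]]] := hch j.
  exists (fun x => Some (existT _ i (f x))); last by move=> x; constructor.
  by split=> [u v /fle ?|w]; [constructor|rewrite -fcol; apply: col_child].
- by exists f.
Qed.

Lemma tree_le_child n c k (ch : 'I_k -> tree n) i : tree_le (Node c ch) (ch i).
Proof.
exists (fun x => Some (existT _ i x)); split=> [u v uv|w]; first by constructor.
exact: col_child.
Qed.

(** The root of [u] cannot go to the root, whose color is [c], so it enters a child, and all that
    lies above stays in that child. *)
Lemma tree_le_color_neq n c k (ch : 'I_k -> tree n) (u : tree n) :
  tree_le (Node c ch) u -> root_color u <> c -> exists i, tree_le (ch i) u.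
Proof.
move=> [h [hle hcol]] uc.
case e : (h (troot u)) => [[i z]|]; last first.
  by case: uc; rewrite -col_troot -hcol e [LHS]col_root.
exists i; have /choice[g gE] (x : tree_model u) :
    exists y : tree_model (ch i), h x = Some (existT _ i y).
  apply: (@add_root_le_above _ c _ (fun l => tree_model (ch l)) i z).
  by rewrite -e; apply/hle/troot_le.
exists g; split=> [x y xy|x].
  apply/(@add_root_le_child _ c _ (fun l => tree_model (ch l)) i).
  by rewrite -!gE; apply: hle.
by have := hcol x; rewrite gE [LHS]col_child.
Qed.

Lemma layered_node n c k (ch : 'I_k -> tree n) :
  (forall i, layered (ch i)) ->
  (forall i j, i <> j -> ~ tree_le (ch i) (ch j)) ->
  (forall i, color_lt c (root_color (ch i))) ->
  layered (Node c ch).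
Proof.
move=> /choice[l hl] hinc hc; case: k ch l hl hinc hc => [|k] ch l hl hinc hc.
  by exists 1; constructor.
(* [layer_next] demands a child in layer [m] itself, so [m] is the maximum of the layers of the
   children. *)
have [|i lE] := eq_bigmax l; first by rewrite card_ord.
exists (\max_i l i).+1; constructor => //.
- by move=> j; exists (l j) => //; apply: leq_bigmax.
- by exists i; rewrite lE.
Qed.

(** The chosen representative of this class is only isomorphic to [t], so the two are compared by
    maps in both directions. *)
Definition tnode n (t : tree n) (ht : layered t) : Tmodel n :=
  (\pi_(Tnode n)%qT (exist _ t (asboolT ht) : layered_tree n))%qT.

Lemma tnode_tree_le n (t : tree n) (ht : layered t) : tree_le t (Ttree (tnode ht)).
Proof.
exact/kripke_iso_le/kripke_iso_sym/(Ttree_pi (exist _ t (asboolT ht))).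
Qed.

Lemma tree_le_tnode n (t : tree n) (ht : layered t) : tree_le (Ttree (tnode ht)) t.
Proof. exact/kripke_iso_le/(Ttree_pi (exist _ t (asboolT ht))). Qed.

Lemma col_tnode n (t : tree n) (ht : layered t) : col (tnode ht) = root_color t.
Proof. exact: Tpi_root_color. Qed.

(** * Pulling MR-formulas back to T(n) *)

Lemma forces_le n (M : nmodel n) (u v : M) a : le u v -> forces u a -> forces v a.
Proof.
have hM := nmodelP M => uv.
elim: a => [k|| a IHa b IHb| a IHa b IHb| a IHa b IHb] //=.
- exact: nm_persistent hM _ _ _ uv.
- by case=> /IHa ? /IHb.
- by case=> [/IHa|/IHb]; [left|right].
- by move=> uab w vw; apply: uab; apply: nm_trans hM _ _ _ uv vw.
Qed.

(* [(u, g) |-> u] is a p-morphism to T(n), while [(u, g) |-> g (root of u)] is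
   color-preserving and monotonic; hence MR-formulas pull back along [g] to T(n). *)
Section TreeMaps.
Variables (n : nat) (M : nmodel n).

Let map_world : Type :=
  {u : Tmodel n & {g : tree_model (Ttree u) -> M | cpm_map g}}.

Let map_le (x y : map_world) : Prop :=
  exists2 h : tree_model (Ttree (tag y)) -> tree_model (Ttree (tag x)),
    cpm_map h & forall z, sval (tagged y) z = sval (tagged x) (h z).

Definition tree_maps : kripke n :=
  @Kripke n map_world map_le (fun k x => root_color (Ttree (tag x)) k).

Lemma tree_maps_nmodel (x : tree_maps) : is_nmodel tree_maps.
Proof.
split.
- by exists x.
- by move=> w; exists id => //; apply: cpm_map_id.
- move=> u v w [h ch hE] [h' ch' hE'].
  exists (fun z => h (h' z)); first exact: cpm_map_comp.
  by move=> z; rewrite hE' hE.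
(* Antisymmetry: once [u = v], rigidity makes [h] the identity, so [g] and [g'] agree. *)
- move=> [u [g cg]] [v [g' cg']] [h /= ch hE] [h' /= ch' hE'].
  have uv : u = v by apply: (nm_antisym (Tkripke_is_nmodel n)); [exists h|exists h'].
  case: v / uv g' cg' h ch hE h' ch' hE' => g' cg' h ch hE h' ch' hE'.
  have gg' : g' = g.
    by apply: funext => z; rewrite hE (layered_rigid (Ttree_layered u) ch).
  case: g / gg' cg {h ch hE h' ch' hE'} => cg.
  by rewrite (Prop_irrelevance cg cg').
- move=> k u v [h ch _].
  by apply: (nm_persistent (Tkripke_is_nmodel n)); exists h.
Qed.

Lemma MR_forces_tree (t : Tmodel n) (g : tree_model (Ttree t) -> M) a :
  MR a -> cpm_map g -> forces (g (troot (Ttree t))) a -> forces t a.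
Proof.
move=> MRa cg ga.
pose w : tree_maps := existT _ t (exist _ g cg).
pose N := NModel (tree_maps_nmodel w).
pose ev (x : N) : M := sval (tagged x) (troot _).
have cev : cpm_map ev.
  split=> [x y [h ch hE]|x]; rewrite /ev.
    rewrite hE; apply: (svalP (tagged x)).1; exact: troot_le.
  rewrite (svalP (tagged x)).2 col_troot.
  by apply/ffunP => k; rewrite ffunE asboolb.
have ctag : cpm_map (fun x : N => tag x : Tmodel n).
  split=> [x y [h ch _]|x]; first by exists h.
  by apply/ffunP => k; rewrite !ffunE.
apply/(forces_pmorphism ctag _ w); last exact: MRa cev w ga.
(* Back condition: a node [v] above [u] through [h] lifts to [v] paired with the composite of [f]
   and [h]. *)
move=> [u [f cf]] v [h ch].
by exists (existT _ v (exist _ (fun z => f (h z)) (cpm_map_comp ch cf))) => //; exists h.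
Qed.

End TreeMaps.

(** * Finiteness of T(n) *)

Fixpoint code_type n m : finType :=
  if m is m'.+1 then (color n * {set code_type n m'})%type : finType
  else unit : finType.

(* The color of the root and the set of codes of the children; it determines a tree
   of T(n) up to isomorphism once [m] exceeds the depth of the tree. *)
Fixpoint code n m (t : tree n) : code_type n m :=
  match m with
  | 0 => tt
  | m'.+1 =>
      let: Node c k ch := t in (c, [set code m' (ch i) | i : 'I_k])
  end.

(** It drops strictly along [color_lt], so at the root it bounds the height of a layered tree. *)
Definition corank n (c : color n) := #|[set k | ~~ c k]|.

Lemma color_lt_witness n (c d : color n) : color_lt c d ->
  exists2 k, ~~ c k & d k.
Proof.
move=> /andP[/color_leP cd ncd]; apply: contrapT => nk.
case/eqP: ncd; apply/ffunP => k; apply/idP/idP => [/cd //|dk].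
by apply: contrapT => /negP ck; apply: nk; exists k.
Qed.

Lemma color_lt_corank n (c d : color n) : color_lt c d -> corank d < corank c.
Proof.
move=> cd; have [k ck dk] := color_lt_witness cd.
have /andP[/color_leP le_cd _] := cd.
apply/proper_card/properP; split.
  by apply/fintype.subsetP => j; rewrite !inE; apply/contra/le_cd.
by exists k; rewrite inE // dk.
Qed.

(** Equal codes match each child of [u] with a child of [t], and the corank drops at children, so
    [m] does not run out first. *)
Lemma code_tree_le n m (t u : tree n) : layered t -> layered u ->
  corank (root_color t) < m -> code m t = code m u -> tree_le t u.
Proof.
elim: m t u => // m IH [c k ch] [d l ch'] ht hu tm [cd].
case: d / cd hu => hu /setP codes; apply: tree_le_node => // j.
have := codes (code m (ch' j)); rewrite [X in _ = X]imset_f //.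
move=> /imsetP[i _ ij]; exists i.
have [hch _ hc] := layered_inv ht; have [hch' _ _] := layered_inv hu.
apply: IH => //; exact: leq_trans (color_lt_corank (hc i)) tm.
Qed.

Lemma Tmodel_finite n :
  exists (F : finType) (f : Tmodel n -> F), injective f.
Proof.
exists (code_type n n.+1), (fun w => code n.+1 (Ttree w)) => u v uv.
(* A corank is at most [n], so [n.+1] levels of code suffice for every node. *)
have rk (w : Tmodel n) : corank (root_color (Ttree w)) < n.+1.
  by rewrite ltnS; apply: leq_trans (max_card _) _; rewrite card_ord.
by apply: (nm_antisym (Tkripke_is_nmodel n)); apply: code_tree_le => //;
  exact: Ttree_layered.
Qed.

Lemma Tmodel_enum n (P : Tmodel n -> Prop) :
  exists L : seq (Tnode n), uniq L /\ forall w, w \in L <-> P w.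
Proof.
have [F [f finj]] := Tmodel_finite n.
pose pick x : option (Tnode n) :=
  if pselect (exists2 w, f w = x & P w) is left h then Some (s2val (cid2 h))
  else None.
exists (undup (pmap pick (enum F))); split; first exact: undup_uniq.
move=> w; rewrite mem_undup mem_pmap; split.
  move=> /mapP[x _]; rewrite /pick; case: pselect => // h [->].
  exact: (s2valP' (cid2 h)).
move=> Pw; apply/mapP; exists (f w); first by rewrite mem_enum.
rewrite /pick; case: pselect => [h|]; last by case; exists w.
by congr Some; apply: finj; rewrite (s2valP (cid2 h)).
Qed.

(** Induction on the number of nodes below [t], counted by their images in the finite type. *)
Lemma Tmodel_minimal n (P : Tmodel n -> Prop) t : P t ->
  exists m : Tmodel n, [/\ P m, le m t & forall s, P s -> le s m -> s = m].
Proof.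
have [F [f finj]] := Tmodel_finite n; have hT := Tkripke_is_nmodel n.
pose D t := [set x | `[< exists2 s, f s = x & le s t >]].
have [k] := ubnP #|D t|; elim: k t => // k IH t Dk Pt.
have [tmin|] := pselect (forall s, P s -> le s t -> s = t).
  by exists t; split=> //; apply: nm_refl hT _.
move=> /existsNP[s /not_implyP[Ps /not_implyP[st nst]]].
have [|//|m [Pm ms mmin]] := IH s.
  rewrite -ltnS; apply: leq_trans Dk; rewrite ltnS.
  apply/proper_card/properP; split.
    apply/fintype.subsetP => x; rewrite !inE => -[r rx rs].
    by exists r => //; apply: nm_trans hT _ _ _ rs st.
  exists (f t); first by rewrite !inE; exists t => //; apply: nm_refl hT _.
  apply/negP; rewrite !inE => -[r /finj -> ts].
  by apply: nst; apply: nm_antisym hT _ _ st ts.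
by exists m; split=> //; apply: nm_trans hT _ _ _ ms st.
Qed.

(** * The least tree mapping into a cone of a model *)

Section TreeApproximation.
Variables (n : nat) (M : nmodel n) (w : M).

Let mapped (t : tree n) : Prop :=
  exists2 g : tree_model t -> M, cpm_map g & forall x, le w (g x).

Let mapped_le t u : tree_le t u -> mapped t -> mapped u.
Proof.
by move=> [h ch] [g cg wg]; exists (fun x => g (h x)) => //; apply: cpm_map_comp.
Qed.

Lemma least_tree : exists t : Tmodel n,
  [/\ col t = col w,
      exists2 g : tree_model (Ttree t) -> M, cpm_map g & forall x, le w (g x)
    & forall (s : Tmodel n) (g : tree_model (Ttree s) -> M),
        cpm_map g -> (forall x, le w (g x)) -> le t s].
Proof.
have hM := nmodelP M.
have col_mapped t : mapped t -> color_le (col w) (root_color t).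
  by move=> [g cg wg]; rewrite -col_troot -cg.2; apply: (col_le hM).
pose P (t : Tmodel n) := mapped (Ttree t) /\ root_color (Ttree t) <> col w.
have [L [Luniq LP]] := @Tmodel_enum n
  (fun t => P t /\ forall s : Tmodel n, P s -> le s t -> s = t).
pose ch (i : 'I_(size L)) := Ttree (tnth (in_tuple L) i).
have LPi i := (LP (tnth (in_tuple L) i)).1 (mem_tnth i _).
(* By finiteness there is a minimal such node below [t], and all minimal ones occur in [ch]. *)
have chP t : layered t -> mapped t -> root_color t <> col w ->
    exists i, tree_le (ch i) t.
  move=> ht mt ct; pose t' := tnode ht.
  have [|m [Pm mt' mmin]] := @Tmodel_minimal n P t'.
    split; first exact: mapped_le (tnode_tree_le ht) mt.
    by rewrite -Tcol col_tnode.
  have /seq_tnthP[i mi] : m \in L by apply/LP.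
  exists i; rewrite /ch -mi.
  exact: kripke_le_trans mt' (tree_le_tnode ht).
have lt : layered (Node (col w) ch).
  apply: layered_node => [i|i j ij ji|i]; first exact: Ttree_layered.
  (* Comparable minimal nodes coincide, and [L] has no repetitions. *)
  - have := (LPi j).2 _ (LPi i).1 ji.
    by move/(elimT (tuple_uniqP (in_tuple L)) Luniq)/ij.
  - have [[mi ci] _] := LPi i; rewrite /color_lt col_mapped //=.
    by apply/eqP => e; apply: ci.
exists (tnode lt); split; first exact: col_tnode.
- apply: (mapped_le (tnode_tree_le lt)).
  have [||i|g cg g0] := @node_map n M (col w) _ ch w.
  + exact: nm_refl hM _.
  + by [].
  + by have [[[g cg wg] _] _] := LPi i; exists g.
  + exists g => // x; rewrite -g0; exact/cg.1/troot_le.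
- move=> s g cg wg; apply: kripke_le_trans (tree_le_tnode lt) _.
  have ms : mapped (Ttree s) by exists g.
  have hs := Ttree_layered s.
  (* If the root color of [s] is not [col w], some [ch i] lies below [s]. If it is, the same holds
     for each child of [s], whose color is strictly larger. *)
  have [cs|cs] := pselect (root_color (Ttree s) = col w); last first.
    have [i it] := chP _ hs ms cs.
    exact: kripke_le_trans (tree_le_child _ _ i) it.
  case: (Ttree s) hs ms cs => c k ch' hs ms /= cs.
  rewrite {c}cs in hs ms *; apply: tree_le_node => // j.
  have [hch' _ hc'] := layered_inv hs.
  apply: chP => //; first exact: mapped_le (tree_le_child _ _ j) ms.
  by move=> e; have := hc' j; rewrite e (negPf (color_lt_irr _)).
Qed.

End TreeApproximation.

Lemma tree_approximation n (M : nmodel n) : exists T : M -> Tmodel n,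
  cpm_map T /\ forall w a, MR a -> forces w a -> forces (T w) a.
Proof.
have hM := nmodelP M.
have /choice[T hT] := @least_tree n M; exists T; split.
  split=> [u v uv|w]; last by have [] := hT w.
  (* [T v] maps into the cone of [v], hence into that of [u], and leastness of [T u] applies. *)
  have [_ _ least] := hT u; have [_ [g cg vg] _] := hT v.
  by apply: (least _ g) => // x; apply: nm_trans hM _ _ _ uv (vg x).
move=> w a MRa wa; have [_ [g cg wg] _] := hT w.
by apply: (MR_forces_tree MRa cg); apply: forces_le wa.
Qed.

(** * NNIL-formulas defining upsets of T(n) *)

(** [Imp Bot Bot] is true everywhere and NNIL, so the empty conjunction stays in the class. *)
Definition bigand n (s : seq (form n)) : form n := foldr (@And n) (Imp Bot Bot) s.
Definition bigor n (s : seq (form n)) : form n := foldr (@Or n) Bot s.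

Lemma NNIL_bigand n (I : Type) (s : seq I) (f : I -> form n) :
  (forall i, NNIL (f i)) -> NNIL (bigand (map f s)).
Proof. by move=> hf; elim: s => //= i s ->; rewrite hf. Qed.

Lemma NNIL_bigor n (I : Type) (s : seq I) (f : I -> form n) :
  (forall i, NNIL (f i)) -> NNIL (bigor (map f s)).
Proof. by move=> hf; elim: s => //= i s ->; rewrite hf. Qed.

Lemma forces_bigand n (M : kripke n) (w : M) (I : eqType) (s : seq I) f :
  forces w (bigand (map f s)) <-> forall i, i \in s -> forces w (f i).
Proof.
elim: s => [|i s IH] /=; first by split.
rewrite IH; split=> [[fi fs] j|fs].
  by rewrite inE => /orP[/eqP->|/fs].
by split=> [|j js]; apply: fs; rewrite inE ?eqxx // js orbT.
Qed.

Lemma forces_bigor n (M : kripke n) (w : M) (I : eqType) (s : seq I) f :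
  forces w (bigor (map f s)) <-> exists2 i, i \in s & forces w (f i).
Proof.
elim: s => [|i s IH] /=; first by split=> // -[].
rewrite IH; split=> [[fi|[j js fj]]|[j]].
- by exists i; rewrite ?inE ?eqxx.
- by exists j; rewrite // inE js orbT.
- by rewrite inE => /orP[/eqP->|js fj]; [left|right; exists j].
Qed.

Lemma NNIL_tree n (t : tree n) : layered t -> exists b : form n,
  NNIL b /\ forall u : Tmodel n, forces u b <-> tree_le t (Ttree u).
Proof.
elim: t => c k ch IH ht; have [hch _ hc] := layered_inv ht.
have /choice[b bP] := fun i => IH i (hch i).
pose f p := if c p then Var p else Imp (Var p) (bigor (map b (enum 'I_k))).
have fP (u : Tmodel n) : forces u (bigand (map f (enum 'I_n))) <->
    forall p, if c p then root_color (Ttree u) p : Prop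
      else forall v : Tmodel n, le u v -> root_color (Ttree v) p ->
        exists i, tree_le (ch i) (Ttree v).
  rewrite forces_bigand; split=> fu p; have {fu} := fu p.
    rewrite mem_enum /f => /(_ isT); case: (c p) => // fu v uv vp.
    have /forces_bigor[i _ /(bP i).2 iv] := fu v uv vp; by exists i.
  rewrite /f => + _; case: (c p) => // fu v uv vp.
  apply: (forces_bigor v (enum 'I_k) b).2.
  by have [i iv] := fu v uv vp; exists i; [rewrite mem_enum|apply/(bP i).2].
exists (bigand (map f (enum 'I_n))); split.
  apply: NNIL_bigand => p; rewrite /f; case: (c p) => //=.
  by apply: NNIL_bigor => i; have [] := bP i.
move=> u; rewrite {}fP; have hu := Ttree_layered u; split=> [fu|tu p].
- have cu : color_le c (root_color (Ttree u)).
    by apply/color_leP => p cp; have := fu p; rewrite cp.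
  (* A strictly larger color makes some [p] outside [c] true, and the conjunct for this [p] yields
     the child. *)
  have {}fu (v : tree n) : layered v -> tree_le (Ttree u) v ->
      color_lt c (root_color v) -> exists i, tree_le (ch i) v.
    move=> hv uv /color_lt_witness[p cp vp].
    have := fu p; rewrite (negPf cp) => /(_ (tnode hv)).
    rewrite -Tcol col_tnode => /(_ (kripke_le_trans uv (tnode_tree_le hv)) vp)[i iv].
    by exists i; apply: kripke_le_trans iv (tree_le_tnode hv).
  (* If the root color of [u] is not [c], the fact above applies to [u] itself, otherwise to each
     child of [u]. *)
  have [uc|cu'] := eqVneq (root_color (Ttree u)) c; last first.
    have [||i iu] := fu _ hu; first exact: kripke_le_refl.
      by rewrite /color_lt cu eq_sym.
    exact: kripke_le_trans (tree_le_child _ _ i) iu.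
  case: (Ttree u) hu uc fu {cu} => d l ch' hu /= uc fu.
  rewrite {d}uc in hu fu *.
  apply: tree_le_node => // j; have [hch' _ hc'] := layered_inv hu.
  by apply: fu => //; apply: tree_le_child.
- case cp: (c p).
    by have /color_leP := tree_le_root_color ht tu; apply.
  (* Truth of [p] at [v] makes its color differ from [c], so a map from [v] into the tree lands in a
     child. *)
  move=> v uv vp; apply: (tree_le_color_neq (kripke_le_trans tu uv)) => vc.
  by rewrite vc cp in vp.
Qed.

Theorem proposition4p10 (n : nat) :
  (forall phi psi : form n, MR phi -> MR psi -> ~ entails phi psi ->
     exists w : Tmodel n, forces w phi /\ ~ forces w psi)
  /\
  (forall U : Tmodel n -> Prop, upset U ->
     exists beta : form n,
       NNIL beta /\ (forall u : Tmodel n, forces u beta <-> U u))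
  /\
  (forall w : Tmodel n,
     exists beta : form n,
       NNIL beta /\ (forall u : Tmodel n, forces u beta <-> le w u)).
Proof.
have beta w := NNIL_tree (@Ttree_layered n w).
split; [|split=> // U Uup].
- move=> phi psi MRphi MRpsi /completeness[M [w [wphi wpsi]]].
  have [T [cT TMR]] := tree_approximation M.
  exists (T w); split; first exact: TMR.
  by move=> /(MRpsi _ _ _ cT).
- have [L [_ LU]] := Tmodel_enum U; have /choice[b bP] := beta.
  exists (bigor (map b L)); split.
    by apply: NNIL_bigor => w; have [] := bP w.
  move=> u; rewrite forces_bigor; split=> [[w /LU Uw /(bP w).2 wu]|Uu].
    exact: Uup wu Uw.
  by exists u; [apply/LU|apply/(bP u).2/kripke_le_refl].
Qed.
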